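(* Let $k\geq 1$ and $n\geq 0$. The Munarini graph $M_{n,k}$ is isomorphic to $\Gamma_{n,k}^\star$. In particular, if $n\geq 1$, then $M_{n,k}$ is isomorphic to a subgraph of the Fibonacci cube $\Gamma_{kn-1}$.
   Context: For integers $k\geq 1$, $n\geq 0$, a $k$-generalized Pell string of length $n$ is a word of length $n$ over the alphabet $\{0,1,\ldots,k\}$ in which every maximal run of the character $k$ has even length (equivalently, a concatenation of letters from $\{0,1,\ldots,k-1,kk\}$). Let $\mathcal{F}_{n,k}$ be the set of these strings (for $n=0$ it contains only the empty string). The Munarini graph $M_{n,k}$ is the simple graph with vertex set $\mathcal{F}_{n,k}$ in which two vertices are adjacent if one of them can be obtained from the other either by replacing one occurrence of $0$ with some $i\in\{1,\ldots,k-1\}$, or by replacing one substring $00$ (two consecutive positions) with $kk$ (both replacements may be read in either direction, and both strings must be in $\mathcal{F}_{n,k}$). The Fibonacci cube $\Gamma_m$ is the subgraph of the hypercube $Q_m$ (vertex set $\{0,1\}^m$, two strings adjacent iff they differ in exactly one coordinate) induced by the binary strings of length $m$ with no two consecutive $1$s; $\Gamma_0=K_1$. Let $A_0=0^k$ and $A_i=0^{i-1}10^{k-i}$ for $i\in\{1,\ldots,k\}$ (binary strings of length $k$). A Munarini string is a binary string that is a concatenation of zero or more strings from $\{A_0,A_1,\ldots,A_{k-1},A_kA_0\}$. Let $\mathcal{F}_{n,k}^\star$ be the set of Munarini strings of length $kn$ (they have no two consecutive $1$s), and let $\Gamma_{n,k}^\star$ be the subgraph of $\Gamma_{kn}$ induced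 by $\mathcal{F}_{n,k}^\star$. *)

(* Defs.v *)
From HB Require Import structures.
From mathcomp Require Import all_boot.

Set Implicit Arguments.
Unset Strict Implicit.
Unset Printing Implicit Defensive.

Record sgraph := SGraph {
  vertex :> finType;
  adj : rel vertex;
  adj_sym : symmetric adj;
  adj_irr : irreflexive adj }.

Definition isomorphic (G H : sgraph) : Prop :=
  exists f : G -> H, bijective f /\ forall x y, adj (f x) (f y) = adj x y.

Section Subgraphs.
Variable G : sgraph.

Section Induced.
Variable P : pred G.
Definition induced_adj : rel {x : G | P x} := fun x y => adj (val x) (val y).
Lemma induced_sym : symmetric induced_adj.
Proof. by move=> x y; apply: adj_sym. Qed.
Lemma induced_irr : irreflexive induced_adj.
Proof. by move=> x; apply: adj_irr. Qed.
Definition induced : sgraph := SGraph induced_sym induced_irr.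
End Induced.

(* Not necessarily induced: any set of vertices, with any set of edges of G   *)
(* between them.                                                              *)
Record subgraph := Subgraph {
  sub_vertices : {set G};
  sub_adj : rel G;
  sub_adj_sym : symmetric sub_adj;
  sub_adj_edge : forall x y, sub_adj x y -> adj x y;
  sub_adj_vertices :
    forall x y, sub_adj x y -> (x \in sub_vertices) && (y \in sub_vertices) }.

Section ToSgraph.
Variable H : subgraph.
Definition subgraph_adj : rel {x : G | x \in sub_vertices H} :=
  fun x y => sub_adj H (val x) (val y).
Lemma subgraph_sym : symmetric subgraph_adj.
Proof. by move=> x y; apply: sub_adj_sym. Qed.
Lemma subgraph_irr : irreflexive subgraph_adj.
Proof. by move=> x; apply/negP => /sub_adj_edge; rewrite adj_irr. Qed.
Definition sgraph_of_subgraph : sgraph := SGraph subgraph_sym subgraph_irr.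
End ToSgraph.
End Subgraphs.

Coercion sgraph_of_subgraph : subgraph >-> sgraph.

Section Munarini.
Variables n k : nat.
Implicit Types w : n.-tuple 'I_k.+1.

(* The letter k is ord_max : 'I_k.+1. The positions p with i <= p < j form a  *)
(* maximal run of it.                                                         *)
Definition max_run w (i j : nat) : bool :=
  [&& i < j,
      [forall p : 'I_n, (i <= p < j) ==> (tnth w p == ord_max)] &
      [forall p : 'I_n, (p.+1 == i) || (p == j :> nat) ==>
                        (tnth w p != ord_max)]].

Definition pell_string w : bool :=
  [forall i : 'I_n.+1, forall j : 'I_n.+1, max_run w i j ==> ~~ odd (j - i)].

Definition replace_letter : rel (n.-tuple 'I_k.+1) := fun w w' =>
  [exists p : 'I_n,
    [&& tnth w p == ord0, 0 < tnth w' p < k &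
        [forall q : 'I_n, (q != p) ==> (tnth w' q == tnth w q)]]].

Definition replace_pair : rel (n.-tuple 'I_k.+1) := fun w w' =>
  [exists p : 'I_n, exists p' : 'I_n,
    [&& p' == p.+1 :> nat,
        tnth w p == ord0, tnth w p' == ord0,
        tnth w' p == ord_max, tnth w' p' == ord_max &
        [forall q : 'I_n, (q != p) && (q != p') ==> (tnth w' q == tnth w q)]]].

Definition replace : rel (n.-tuple 'I_k.+1) :=
  fun w w' => replace_letter w w' || replace_pair w w'.

Definition munarini_adj : rel {w : n.-tuple 'I_k.+1 | pell_string w} :=
  fun x y => replace (val x) (val y) || replace (val y) (val x).

Lemma munarini_sym : symmetric munarini_adj.
Proof. by move=> x y; apply: orbC. Qed.

Lemma munarini_irr : 0 < k -> irreflexive munarini_adj.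
Proof.
move=> k_gt0 x; rewrite /munarini_adj orbb; apply/negP => /orP[].
  by case/existsP=> p /and3P[/eqP->].
case/existsP=> p /existsP[p' /and5P[_ /eqP-> _ /eqP/(congr1 val)/= k0 _]].
by rewrite -k0 in k_gt0.
Qed.

Definition munarini_graph (k_gt0 : 0 < k) : sgraph :=
  SGraph munarini_sym (munarini_irr k_gt0).
End Munarini.

Section Hypercube.
Variable m : nat.
Definition hypercube_adj : rel (m.-tuple bool) :=
  fun x y => #|[set i | tnth x i != tnth y i]| == 1.
Lemma hypercube_sym : symmetric hypercube_adj.
Proof.
move=> x y; rewrite /hypercube_adj; congr (_ == 1); apply: eq_card => i.
by rewrite !inE eq_sym.
Qed.
Lemma hypercube_irr : irreflexive hypercube_adj.
Proof.
move=> x; rewrite /hypercube_adj (_ : [set _ | _] = set0) ?cards0 //.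
by apply/setP=> i; rewrite !inE eqxx.
Qed.
Definition hypercube : sgraph := SGraph hypercube_sym hypercube_irr.

Definition fibonacci_string (x : m.-tuple bool) : bool :=
  [forall i : 'I_m, forall j : 'I_m,
    (j == i.+1 :> nat) ==> ~~ (tnth x i && tnth x j)].

Definition fibonacci_cube : sgraph := @induced hypercube fibonacci_string.
End Hypercube.

Section MunariniStrings.
Variable k : nat.

Definition A (i : nat) : seq bool :=
  if i == 0 then nseq k false else nseq i.-1 false ++ true :: nseq (k - i) false.

(* The generators A_0, ..., A_{k-1}, A_k A_0, indexed by 0, ..., k.           *)
Definition munarini_block (i : 'I_k.+1) : seq bool :=
  if i == ord_max then A k ++ A 0 else A i.

(* At most size s generators are allowed, so that the predicate is boolean;   *)
(* no generator is empty when k >= 1, so this is no restriction: see          *)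
(* munarini_stringP.                                                          *)
Definition munarini_string (s : seq bool) : bool :=
  [exists bs : {bseq (size s) of 'I_k.+1},
    s == flatten [seq munarini_block i | i <- bs]].

Lemma size_A i : 0 < k -> i <= k -> size (A i) = k.
Proof.
move=> k_gt0 ik; rewrite /A; case: eqP => [_|/eqP i0]; first by rewrite size_nseq.
rewrite size_cat /= !size_nseq addnS -addSn prednK ?lt0n //.
by rewrite subnKC.
Qed.

Lemma size_munarini_block i : 0 < k -> 0 < size (munarini_block i).
Proof.
move=> k_gt0; rewrite /munarini_block; case: ifP => _.
  by rewrite size_cat size_A // ltn_addr.
by rewrite size_A // -ltnS.
Qed.

Lemma munarini_stringP s : 0 < k ->
  reflect (exists bs : seq 'I_k.+1, s = flatten [seq munarini_block i | i <- bs])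
          (munarini_string s).
Proof.
move=> k_gt0; apply: (iffP existsP) => [[bs /eqP E]|[bs E]]; first by exists bs.
suff sz : size bs <= size s by exists (Bseq sz); apply/eqP.
rewrite {s}E; elim: bs => //= i bs IH; rewrite size_cat.
by rewrite -add1n leq_add // size_munarini_block.
Qed.
End MunariniStrings.

Lemma munarini_string_fibonacci k m (x : m.-tuple bool) :
  0 < k -> munarini_string k x -> fibonacci_string x.
Proof.
move=> k_gt0 /(munarini_stringP _ k_gt0)[bs E].
pose R (a b : bool) := ~~ (a && b).
pose good s := path R false s && ~~ last false s.
have good_nil : good [::] by [].
have good_cat s t : good s -> good t -> good (s ++ t).
  by case/andP=> ps ls /andP[pt lt]; rewrite /good cat_path last_cat ps (negPf ls) pt.
have p0 j : path R false (nseq j false) by elim: j.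
have l0 j : last false (nseq j false) = false by elim: j.
have p1 j : path R true (nseq j false) by case: j => //= j; rewrite p0.
have l1 j : last true (nseq j false) = (j == 0) by case: j => //= j; rewrite l0.
have goodA i : i < k -> good (A k i).
  move=> ik; rewrite /good /A; case: eqP => _; first by rewrite p0 l0.
  by rewrite cat_path last_cat /= p0 l0 p1 l1 /= -lt0n subn_gt0.
have goodkk : good (A k k ++ A k 0).
  rewrite /good /A eqxx -[k == 0]negbK -lt0n k_gt0 /= subnn -catA.
  rewrite cat_path p0 l0 /= p1 last_cat /= l1.
  by rewrite -lt0n.
have : good (x : seq bool).
  rewrite E; elim: bs {E} => //= i bs IH; apply: good_cat => //.
  rewrite /munarini_block; case: eqP => // /eqP i_max; apply: goodA.
  by rewrite ltn_neqAle -ltnS ltn_ord andbT.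
case/andP=> /(pathP false) Px _; apply/forallP=> i; apply/forallP=> j.
apply/implyP=> /eqP ij; have := Px j; rewrite size_tuple ltn_ord => /(_ isT).
by rewrite ij /= -ij !(tnth_nth false).
Qed.

Definition munarini_subcube (n k : nat) : sgraph :=
  @induced (fibonacci_cube (k * n))
           (fun x => munarini_string k (val x)).

(* Main.v *)
Require Import Defs.
From mathcomp Require Import all_boot.
From mathcomp Require Import zify.

Set Implicit Arguments.
Unset Strict Implicit.
Unset Printing Implicit Defensive.

(** Replacing every second letter of each run of [k] by [0] turns the Pell
    strings into the words, called reduced here, in which every letter [k] is
    followed by a [0], and turns both kinds of edges of the Munarini graph into
    the replacement of a single letter [0] by a nonzero one.  The block [A_0] is
    zero and [A_1, ..., A_k] are the unit vectors, so the blocks of two distinct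
    letters [i], [j] are at Hamming distance [(i != 0) + (j != 0)]; hence two
    words encoded letterwise are at distance 1 exactly when they differ in one
    letter, which is [0] in one of them.  The encoded reduced words are the
    Munarini strings.  They all end with a [0], which can be dropped without
    changing any distance. *)

(** * Embeddings of graphs *)

Definition embedding (G H : sgraph) (f : G -> H) : Prop :=
  injective f /\ forall x y, adj (f x) (f y) = adj x y.

Lemma embedding_comp (G H K : sgraph) (f : G -> H) (g : H -> K) :
  embedding f -> embedding g -> embedding (g \o f).
Proof.
case=> f_inj f_adj [g_inj g_adj]; split; first exact: inj_comp.
by move=> x y; rewrite /= g_adj f_adj.
Qed.

Lemma embedding_surj_isomorphic (G H : sgraph) (f : G -> H) :
  embedding f -> (forall y, y \in codom f) -> isomorphic G H.
Proof.
case=> f_inj f_adj f_surj; exists f; split=> //.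
by exists (fun y => iinv (f_surj y)) => [x|y]; [apply: iinv_f | apply: f_iinv].
Qed.

Lemma embedding_isomorphic_subgraph (G H : sgraph) (f : G -> H) :
  embedding f -> exists S : subgraph H, isomorphic G S.
Proof.
case=> f_inj f_adj; pose V := [set y in codom f].
pose e : rel H := fun y z => [&& adj y z, y \in V & z \in V].
have e_sym : symmetric e.
  by move=> y z; rewrite /e adj_sym [(y \in V) && _]andbC.
have e_edge y z : e y z -> adj y z by case/and3P.
have e_vertices y z : e y z -> (y \in V) && (z \in V) by case/and3P=> _ -> ->.
have f_V x : f x \in V by rewrite inE codom_f.
pose S := Subgraph e_sym e_edge e_vertices; exists S.
pose g x : S := exist _ (f x) (f_V x).
apply: (@embedding_surj_isomorphic _ _ g); first split=> [x y [/f_inj]|x y] //.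
  by rewrite [LHS]/(e (f x) (f y)) /e !f_V !andbT f_adj.
move=> [y y_V]; have := y_V; rewrite inE => /codomP[x y_fx].
by apply/codomP; exists x; apply: val_inj.
Qed.

(** * Hamming distance *)

Section Hamming.
Variable T : eqType.
Implicit Types s t : seq T.

Definition hamming s t : nat := count (fun p => p.1 != p.2) (zip s t).

Lemma hamming_cons x s y t :
  hamming (x :: s) (y :: t) = (x != y) + hamming s t.
Proof. by []. Qed.

Lemma hamming_cat s1 s2 t1 t2 : size s1 = size t1 ->
  hamming (s1 ++ s2) (t1 ++ t2) = hamming s1 t1 + hamming s2 t2.
Proof. by move=> eq_size; rewrite /hamming zip_cat // count_cat. Qed.

Lemma hamming_map (I : Type) (f g : I -> T) (r : seq I) :
  hamming (map f r) (map g r) = count (fun i => f i != g i) r.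
Proof. by rewrite /hamming zip_map count_map. Qed.

Lemma hamming_refl s : hamming s s = 0.
Proof. by elim: s => //= x s IH; rewrite hamming_cons eqxx. Qed.

Lemma hamming_sym s t : hamming s t = hamming t s.
Proof.
by elim: s t => [|x s IH] [|y t] //; rewrite !hamming_cons IH eq_sym.
Qed.

Lemma hamming_eq0 s t : size s = size t -> (hamming s t == 0) = (s == t).
Proof.
elim: s t => [|x s IH] [|y t] //= [/IH IHt].
by rewrite hamming_cons addn_eq0 eqb0 negbK IHt.
Qed.

Lemma hamming_drop_last x0 s t : size s = size t -> last x0 s = last x0 t ->
  hamming (take (size s - 1) s) (take (size t - 1) t) = hamming s t.
Proof.
case/lastP: s => [|s x]; case/lastP: t => [|t y] //; rewrite ?size_rcons //.
move=> [eq_size]; rewrite !last_rcons => ->.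
by rewrite !subn1 -!cats1 !take_size_cat // hamming_cat // hamming_refl addn0.
Qed.

Lemma card_tnth_neq n (s t : n.-tuple T) :
  #|[set i | tnth s i != tnth t i]| = hamming s t.
Proof.
rewrite -sum1dep_card big_mkcond /=; elim: n s t => [|n IH] s t.
  by rewrite big_ord0 (tuple0 s) (tuple0 t) hamming_refl.
case/tupleP: s => x s; case/tupleP: t => y t.
rewrite big_ord_recl !tnth0 hamming_cons -IH; congr (_ + _).
by apply: eq_bigr => i _; rewrite !tnthS.
Qed.

End Hamming.

Lemma adj_fibonacci_cube m (x y : fibonacci_cube m) :
  adj x y = (hamming (val x) (val y) == 1).
Proof. by rewrite -card_tnth_neq. Qed.

(** * Words and their reduction *)

Definition in_context (T : Type) (rule : seq T -> seq T -> Prop) (s t : seq T) :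
    Prop :=
  exists a c l r, [/\ rule l r, s = a ++ l ++ c & t = a ++ r ++ c].

Inductive raise_rule (T : eqType) (zero : T) : seq T -> seq T -> Prop :=
  RaiseLetter x of x != zero : raise_rule zero [:: zero] [:: x].

Inductive pell_rule (T : eqType) (zero top : T) : seq T -> seq T -> Prop :=
| PellLetter x of x != zero & x != top : pell_rule zero top [:: zero] [:: x]
| PellPair : pell_rule zero top [:: zero; zero] [:: top; top].

Lemma last_scanl (T1 T2 : Type) (g : T1 -> T2 -> T1) x s :
  last x (scanl g x s) = foldl g x s.
Proof. by elim: s x => //=. Qed.

Section PairedLetter.
Variables (T : eqType) (zero top : T).
Hypothesis zero_neq_top : zero != top.
Implicit Types (x y : T) (u v w a c : seq T).

Lemma top_neq_zero : (top == zero) = false.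
Proof. by rewrite eq_sym (negPf zero_neq_top). Qed.

(* In a Pell string the letter following an odd-numbered [top] of a run is
   [top], and becomes [zero].  Exchanging the two letters, rather than only
   erasing [top], makes the reduction invertible on all words. *)
Definition swap_after y x : T :=
  if y == top then [fun z => z with zero |-> top, top |-> zero] x else x.

Local Notation reduce_from := (scanl swap_after).
Local Notation expand_from := (pairmap swap_after).
Local Notation reduce := (reduce_from zero).
Local Notation expand := (expand_from zero).

Lemma swap_after_id y x : y != top -> swap_after y x = x.
Proof. by rewrite /swap_after => /negPf->. Qed.

Lemma swap_after_top_zero : swap_after top zero = top.
Proof. by rewrite /swap_after /= !eqxx. Qed.

Lemma swap_after_top_top : swap_after top top = zero.
Proof. by rewrite /swap_after /= top_neq_zero eqxx. Qed.

Lemma swap_afterK y : involutive (swap_after y).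
Proof.
move=> x; rewrite /swap_after; case: (y == top) => //=.
case: (eqVneq x zero) => [->|x_zero]; first by rewrite top_neq_zero eqxx.
case: (eqVneq x top) => [->|x_top]; first by rewrite eqxx.
by rewrite (negPf x_zero) (negPf x_top).
Qed.

Lemma reduceK : cancel reduce expand.
Proof. exact: scanlK swap_afterK zero. Qed.

Lemma expandK : cancel expand reduce.
Proof. exact: pairmapK swap_afterK zero. Qed.

Lemma reduce_from_neq_top y w : y != top -> reduce_from y w = reduce w.
Proof. by case: w => //= x w y_top; rewrite !swap_after_id. Qed.

Lemma expand_from_neq_top y u : y != top -> expand_from y u = expand u.
Proof. by case: u => //= x u y_top; rewrite !swap_after_id. Qed.

Lemma foldl_swap_after_nseq y m :
  (foldl swap_after y (nseq m top) == top) = (y == top) (+) odd m.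
Proof.
elim: m y => [|m IH] y /=; first by rewrite addbF.
rewrite IH addbN -addNb; congr (_ (+) _).
case: (eqVneq y top) => [->|y_top]; last by rewrite swap_after_id ?eqxx.
by rewrite swap_after_top_top (negPf zero_neq_top).
Qed.

Definition zero_after_top : rel T := fun y x => (y == top) ==> (x == zero).

Definition reduced_from y u : bool :=
  path zero_after_top y u && (last y u != top).

Definition reduced u : bool := reduced_from zero u.

Lemma reduced_from_cons y x u :
  reduced_from y (x :: u) = zero_after_top y x && reduced_from x u.
Proof. by rewrite /reduced_from /= andbA. Qed.

Lemma reduced_from_neq_top y u : y != top -> reduced_from y u = reduced u.
Proof.
rewrite /reduced => y_top; case: u => [|x u].
  by rewrite /reduced_from /= y_top.
rewrite !reduced_from_cons /zero_after_top.
by rewrite (negPf y_top) (negPf zero_neq_top).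
Qed.

Lemma reduced_from_cat y a c :
  reduced_from y (a ++ c) -> reduced_from (last y a) c.
Proof. by rewrite /reduced_from cat_path last_cat => /andP[/andP[_ ->]]. Qed.

Lemma reduced_reduce_from_cons y x w :
  reduced_from y (reduce_from y (x :: w)) =
  ((y == top) ==> (x == top)) &&
  reduced_from (swap_after y x) (reduce_from (swap_after y x) w).
Proof.
rewrite reduced_from_cons /zero_after_top; congr (_ && _).
case: eqP => //= ->; rewrite -(inj_eq (can_inj (swap_afterK top))) swap_afterK.
by rewrite swap_after_top_zero.
Qed.

Lemma foldl_swap_after_neq_top y a x w : x != top ->
  reduced_from y (reduce_from y (a ++ x :: w)) -> foldl swap_after y a != top.
Proof.
move=> x_top; rewrite scanl_cat => /reduced_from_cat.
rewrite last_scanl reduced_reduce_from_cons => /andP[y_x _].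
by apply: contraTN y_x => ->.
Qed.

Definition reduced_block x : seq T :=
  if x == top then [:: top; zero] else [:: x].

Lemma reduced_flatten_blocks v :
  reduced (flatten [seq reduced_block x | x <- v]).
Proof.
rewrite /reduced; elim: v => [|x v IH]; first by rewrite /reduced_from /=.
rewrite /= {1}/reduced_block; case: (eqVneq x top) => [_|x_top] /=.
  by rewrite !reduced_from_cons /zero_after_top (negPf zero_neq_top) !eqxx.
rewrite reduced_from_cons /zero_after_top (negPf zero_neq_top).
by rewrite reduced_from_neq_top.
Qed.

Lemma reducedP u :
  reflect (exists v, u = flatten [seq reduced_block x | x <- v]) (reduced u).
Proof.
apply: (iffP idP) => [|[v ->]]; last exact: reduced_flatten_blocks.
have [m] := ubnP (size u); elim: m u => // m IH [|x u]; first by exists [::].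
rewrite ltnS /reduced reduced_from_cons => u_m /andP[_].
case: (eqVneq x top) => [->|x_top] red_u; last first.
  rewrite reduced_from_neq_top // in red_u; have [v ->] := IH _ u_m red_u.
  by exists (x :: v); rewrite /= {2}/reduced_block (negPf x_top).
case: u red_u u_m => [|y u]; first by rewrite /reduced_from /= eqxx.
rewrite reduced_from_cons /zero_after_top eqxx => /andP[/eqP-> red_u] /ltnW u_m.
have [v ->] := IH _ u_m red_u.
by exists (top :: v); rewrite /= {2}/reduced_block eqxx.
Qed.

(* [zero] stands for the missing neighbour of a run at an end of the word. *)
Definition even_runs w : Prop := forall a m c, w = a ++ nseq m top ++ c ->
  last zero a != top -> head zero c != top -> ~~ odd m.

Lemma reduced_even_runs w : reduced (reduce w) -> even_runs w.
Proof.
rewrite /reduced => red a m c wE a_top c_top; rewrite {}wE in red.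
have y_top : foldl swap_after zero a != top.
  case/lastP: a red a_top => [|a x] //.
  rewrite cat_rcons last_rcons foldl_rcons => red x_top.
  have y_top := foldl_swap_after_neq_top x_top red.
  by rewrite swap_after_id.
have -> : odd m = (foldl swap_after zero (a ++ nseq m top) == top).
  by rewrite foldl_cat foldl_swap_after_nseq (negPf y_top).
rewrite catA in red; case: c c_top red => [|x c] x_top red.
  by move: red; rewrite cats0 => /andP[_]; rewrite last_scanl.
exact: foldl_swap_after_neq_top x_top red.
Qed.

Lemma even_runs_reduced w : even_runs w -> reduced (reduce w).
Proof.
move=> even_w.
suff reduced_suffix a m v y : w = a ++ nseq m top ++ v -> last zero a != top ->
    (y == top) = odd m -> reduced_from y (reduce_from y v).
  by apply: (reduced_suffix [::] 0); rewrite ?(negPf zero_neq_top).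
elim: v a m y => [|x v IH] a m y wE a_top y_odd.
  by rewrite /reduced_from /= y_odd; apply: even_w wE _ _.
rewrite reduced_reduce_from_cons; case: (eqVneq x top) => [x_top|x_top].
  rewrite implybT; apply: (IH a m.+1) => //.
    by rewrite wE x_top -addn1 nseqD -catA.
  have := foldl_swap_after_nseq y 1; rewrite /= x_top y_odd => ->.
  by rewrite addbT.
have y_top : y != top by rewrite y_odd; apply: even_w wE _ _.
rewrite swap_after_id // implybF y_top.
apply: (IH (rcons (a ++ nseq m top) x) 0).
- by rewrite wE cat_rcons -catA.
- by rewrite last_rcons.
- exact: negPf.
Qed.

Lemma reduced_reduceP w : reflect (even_runs w) (reduced (reduce w)).
Proof.
by apply: (iffP idP) => [/reduced_even_runs|/even_runs_reduced].
Qed.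

Lemma pell_raise_reduce w w' : reduced (reduce w) ->
  in_context (pell_rule zero top) w w' ->
  in_context (raise_rule zero) (reduce w) (reduce w').
Proof.
move=> red [a [c [l [r [rule_lr wE ->]]]]]; rewrite {}wE in red *.
have y_top : foldl swap_after zero a != top.
  by case: rule_lr red => [x _ _|]; apply: foldl_swap_after_neq_top.
rewrite !scanl_cat; case: rule_lr => [x x_zero x_top|].
  exists (reduce a), (reduce c), [:: zero], [:: x].
  split; [exact: RaiseLetter | by rewrite /= swap_after_id |].
  by rewrite /= swap_after_id // (reduce_from_neq_top _ x_top).
exists (reduce a), (zero :: reduce c), [:: zero], [:: top].
split; [by constructor; rewrite top_neq_zero | by rewrite /= !swap_after_id |].
by rewrite /= swap_after_id // swap_after_top_top.
Qed.

Lemma raise_pell_expand u u' : reduced u' ->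
  in_context (raise_rule zero) u u' ->
  in_context (pell_rule zero top) (expand u) (expand u').
Proof.
move=> red [a [c [l [r [[x x_zero] -> u'E]]]]].
rewrite {}u'E !pairmap_cat in red *; move/reduced_from_cat: red.
rewrite reduced_from_cons => /andP[a_x red_c].
have a_top : last zero a != top.
  apply: contraTN a_x => /eqP->.
  by rewrite /zero_after_top eqxx (negPf x_zero).
case: (eqVneq x top) red_c => [->|x_top] red_c; last first.
  exists (expand a), (expand c), [:: zero], [:: x].
  split; [exact: PellLetter | by rewrite /= swap_after_id |].
  by rewrite /= swap_after_id // (expand_from_neq_top _ x_top).
case: c red_c => [|y c]; first by case/andP; rewrite /= eqxx.
rewrite reduced_from_cons /zero_after_top eqxx => /andP[/eqP-> _].
exists (expand a), (expand c), [:: zero; zero], [:: top; top].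
split; [exact: PellPair | by rewrite /= !swap_after_id |].
by rewrite /= swap_after_id // swap_after_top_zero.
Qed.

Lemma pell_rule_reduce w w' : reduced (reduce w) -> reduced (reduce w') ->
  in_context (pell_rule zero top) w w' <->
  in_context (raise_rule zero) (reduce w) (reduce w').
Proof.
move=> red red'; split; first exact: pell_raise_reduce.
by move/(raise_pell_expand red'); rewrite !reduceK.
Qed.

End PairedLetter.

(** * Tuples that agree outside a window *)

Section Window.
Variables (T : Type) (x0 : T).
Implicit Types s t a l r c : seq T.

Lemma nth_window a l c i :
  i < size l -> nth x0 (a ++ l ++ c) (size a + i) = nth x0 l i.
Proof. by move=> i_l; rewrite nth_cat ltnNge leq_addr addKn nth_cat i_l. Qed.

Lemma nth_outside_window a l r c i :
  size l = size r -> ~~ (size a <= i < size a + size l) ->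
  nth x0 (a ++ l ++ c) i = nth x0 (a ++ r ++ c) i.
Proof.
move=> eq_size i_out; rewrite !nth_cat -eq_size; case: ltnP => // a_i.
by have -> : (i - size a < size l) = false by lia.
Qed.

Lemma forall_tnthP n (P : nat -> pred T) (s : n.-tuple T) :
  reflect (forall i, i < n -> P i (nth x0 s i))
          [forall i : 'I_n, P i (tnth s i)].
Proof.
apply: (iffP forallP) => Ps i; last by rewrite (tnth_nth x0); apply: Ps.
by move=> i_n; have := Ps (Ordinal i_n); rewrite (tnth_nth x0).
Qed.

Lemma forall_window n (P : pred T) (s : n.-tuple T) a l c :
  tval s = a ++ l ++ c ->
  [forall i : 'I_n, (size a <= i < size a + size l) ==> P (tnth s i)] = all P l.
Proof.
move=> sE; have size_s : size a + (size l + size c) = n.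
  by rewrite -!size_cat -sE size_tuple.
apply/(forall_tnthP (fun i x => (_ <= i < _) ==> _ x))/(all_nthP x0).
  move=> Ps i i_l; have := Ps (size a + i); rewrite sE nth_window //.
  by rewrite leq_addr ltn_add2l i_l; apply; lia.
move=> Pl i i_n; apply/implyP=> /andP[a_i i_al].
by rewrite sE -(subnKC a_i) nth_window; [apply: Pl|]; lia.
Qed.

Lemma forall_window_ends n (P : pred T) (s : n.-tuple T) a l c :
  P x0 -> tval s = a ++ l ++ c ->
  [forall i : 'I_n, (i.+1 == size a) || (i == size a + size l :> nat) ==>
                    P (tnth s i)] =
  P (last x0 a) && P (head x0 c).
Proof.
move=> P_x0 sE; have size_s : size a + (size l + size c) = n.
  by rewrite -!size_cat -sE size_tuple.
apply/(forall_tnthP (fun i x => (i.+1 == _) || (i == _) ==> _ x))/andP.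
  move=> Ps; split.
    case/lastP: a sE size_s Ps => [|a x] //.
    rewrite size_rcons last_rcons => sE size_s /(_ (size a)).
    by rewrite sE cat_rcons nth_cat ltnn subnn eqxx; apply; lia.
  case: c sE size_s Ps => [|x c] // sE size_s /(_ (size a + size l)).
  rewrite sE catA -size_cat nth_cat ltnn subnn eqxx orbT; apply=> //.
  by rewrite size_cat /= in size_s *; lia.
case=> P_last P_head i i_n; apply/implyP=> /orP[]/eqP iE; last first.
  by rewrite sE catA nth_cat size_cat iE ltnn subnn nth0.
by rewrite sE nth_cat -iE ltnSn; move: P_last; rewrite -nth_last -iE.
Qed.

Lemma splice_window n (s t : n.-tuple T) p m :
  (forall i : 'I_n, ~~ (p <= i < p + m) -> tnth t i = tnth s i) ->
  tval t = take p s ++ take m (drop p t) ++ drop (p + m) s.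
Proof.
move=> agree.
have {}agree i : i < n -> ~~ (p <= i < p + m) -> nth x0 t i = nth x0 s i.
  by move=> i_n /(agree (Ordinal i_n)); rewrite !(tnth_nth x0).
rewrite -{1}(cat_take_drop p t) -{1}(cat_take_drop m (drop p t)).
rewrite drop_drop addnC; congr (_ ++ (_ ++ _)).
  apply: (@eq_from_nth _ x0) => [|i]; first by rewrite !size_take !size_tuple.
  rewrite size_take size_tuple => i_p.
  have {}i_p : i < p /\ i < n by case: ifP i_p; lia.
  by rewrite !nth_take ?agree //; lia.
apply: (@eq_from_nth _ x0) => [|i]; first by rewrite !size_drop !size_tuple.
by rewrite size_drop size_tuple => i_n; rewrite !nth_drop agree //; lia.
Qed.

Lemma splice_tnth n (s t : n.-tuple T) (p : 'I_n) :
  (forall i, i != p -> tnth t i = tnth s i) ->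
  tval t = take p s ++ [:: tnth t p] ++ drop p.+1 s.
Proof.
move=> agree; rewrite {1}(@splice_window _ s t p 1) => [|i i_p].
  by rewrite (drop_nth x0) ?size_tuple //= take0 (tnth_nth x0) addn1.
by apply: agree; rewrite -val_eqE /=; lia.
Qed.

Lemma splice_tnth2 n (s t : n.-tuple T) (p p' : 'I_n) : p' = p.+1 :> nat ->
  (forall i, (i != p) && (i != p') -> tnth t i = tnth s i) ->
  tval t = take p s ++ [:: tnth t p; tnth t p'] ++ drop p.+2 s.
Proof.
move=> p'E agree; have p'_n := ltn_ord p'; rewrite p'E in p'_n.
rewrite {1}(@splice_window _ s t p 2) => [|i i_pp'].
  rewrite (drop_nth x0) ?size_tuple // (drop_nth x0) ?size_tuple //= take0.
  by rewrite !(tnth_nth x0) p'E addn2.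
by apply: agree; rewrite -!val_eqE /= p'E; lia.
Qed.

End Window.

(** * Pell strings *)

Lemma ord0_neq_max k : 0 < k -> ord0 != ord_max :> 'I_k.+1.
Proof. by rewrite -val_eqE /= eq_sym -lt0n. Qed.

Section PellStrings.
Variables k n : nat.
Implicit Types (w : n.-tuple 'I_k.+1) (a l c : seq 'I_k.+1).

Lemma max_run_cat w a l c : 0 < k -> tval w = a ++ l ++ c ->
  max_run w (size a) (size (a ++ l)) =
  [&& 0 < size l, all (pred1 ord_max) l,
      last ord0 a != ord_max & head ord0 c != ord_max].
Proof.
move=> k_gt0 wE; rewrite /max_run size_cat -[X in X < _]addn0 ltn_add2l.
rewrite (forall_window ord0 (pred1 ord_max) wE).
by rewrite (forall_window_ends (P := predC1 ord_max) (ord0_neq_max k_gt0) wE).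
Qed.

Lemma pell_stringP w :
  0 < k -> reflect (even_runs ord0 ord_max w) (pell_string w).
Proof.
move=> k_gt0; apply: (iffP forallP) => [even_w a m c wE a_end c_start|even_w i].
  case: (posnP m) => [->|m_gt0] //.
  have size_w : size a + (m + size c) = n.
    by rewrite -(size_tuple w) wE !size_cat size_nseq.
  have a_n : size a < n.+1 by lia.
  have am_n : size (a ++ nseq m ord_max) < n.+1.
    by rewrite size_cat size_nseq; lia.
  have /forallP/(_ (Ordinal am_n)) := even_w (Ordinal a_n).
  rewrite (max_run_cat k_gt0 wE) size_nseq m_gt0 all_pred1_nseq a_end c_start.
  by rewrite /= size_cat size_nseq addKn.
apply/forallP=> j; apply/implyP=> run_ij.
have i_j : i < j by case/and3P: run_ij.
have take_ij : take i w ++ drop i (take j w) = take j w.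
  by rewrite -(take_takel w (ltnW i_j)) cat_take_drop.
have wE : tval w = take i w ++ drop i (take j w) ++ drop j w.
  by rewrite catA take_ij cat_take_drop.
have size_take_w (p : 'I_n.+1) : size (take p w) = p.
  by rewrite size_takel // size_tuple -ltnS.
have := max_run_cat k_gt0 wE; rewrite take_ij !size_take_w run_ij.
case/esym/and4P=> _ /all_pred1P run_l a_end c_start.
rewrite size_drop size_take_w in run_l; rewrite run_l in wE.
exact: even_w wE a_end c_start.
Qed.

Lemma replace_pell_rule w w' :
  replace w w' -> in_context (pell_rule ord0 ord_max) w w'.
Proof.
case/orP=> [/existsP[p]|/existsP[p /existsP[p']]].
  case/and3P=> /eqP w_p /andP[w'_p w'_lt] /forallP agree.
  exists (take p w), (drop p.+1 w), [:: ord0], [:: tnth w' p]; split.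
  - by apply: PellLetter; rewrite -val_eqE /=; lia.
  - by rewrite -w_p; apply: (splice_tnth ord0).
  - apply: (splice_tnth ord0) => q q_p; apply/eqP.
    exact: (implyP (agree q)).
case/and5P=> /eqP p'E /eqP w_p /eqP w_p' /eqP w'_p.
case/andP=> /eqP w'_p' /forallP agree.
exists (take p w), (drop p.+2 w), [:: ord0; ord0], [:: ord_max; ord_max].
split; first exact: PellPair.
- by rewrite -{1}w_p -w_p'; apply: (splice_tnth2 ord0).
- rewrite -{1}w'_p -w'_p'; apply: (splice_tnth2 ord0) => // q q_pp'; apply/eqP.
  exact: (implyP (agree q)).
Qed.

Lemma replace_letter_cat w w' a c (x : 'I_k.+1) : x != ord0 -> x != ord_max ->
  tval w = a ++ ord0 :: c -> tval w' = a ++ x :: c ->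
  replace_letter w w'.
Proof.
move=> x_zero x_max wE w'E; have p_n : size a < n.
  by have := size_tuple w; rewrite wE size_cat /=; lia.
have x_range : 0 < x < k.
  by have := ltn_ord x; rewrite -!val_eqE /= in x_zero x_max; lia.
apply/existsP; exists (Ordinal p_n).
rewrite !(tnth_nth ord0) /= wE w'E !nth_cat ltnn subnn /= x_range /=.
apply/forallP=> q; apply/implyP; rewrite -val_eqE /= => q_p.
rewrite !(tnth_nth ord0) wE w'E.
by rewrite (@nth_outside_window _ _ a [:: x] [:: ord0]) //=; lia.
Qed.

Lemma replace_pair_cat w w' a c :
  tval w = a ++ [:: ord0, ord0 & c] ->
  tval w' = a ++ [:: ord_max, ord_max & c] -> replace_pair w w'.
Proof.
move=> wE w'E; have p'_n : (size a).+1 < n.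
  by have := size_tuple w; rewrite wE size_cat /=; lia.
apply/existsP; exists (Ordinal (ltnW p'_n)).
apply/existsP; exists (Ordinal p'_n).
rewrite !(tnth_nth ord0) /= wE w'E !nth_cat ltnn subnn ltnNge leqnSn subSnn /=.
rewrite !eqxx /=; apply/forallP=> q; apply/implyP.
rewrite -!val_eqE /= => q_pp'.
rewrite !(tnth_nth ord0) wE w'E.
rewrite (@nth_outside_window _ _ a [:: ord_max; ord_max] [:: ord0; ord0]) //=.
by lia.
Qed.

Lemma replaceP w w' :
  reflect (in_context (pell_rule ord0 ord_max) w w') (replace w w').
Proof.
apply: (iffP idP); first exact: replace_pell_rule.
case=> a [c [l [r [[x x_zero x_max|] wE w'E]]]]; apply/orP; [left | right].
  exact: replace_letter_cat wE w'E.
exact: replace_pair_cat wE w'E.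
Qed.

End PellStrings.

(** * Block codes at the distances of unit vectors *)

Section BlockCode.
Variables (T : eqType) (zero : T) (code : T -> seq bool) (m : nat).
Hypothesis size_code : forall x, size (code x) = m.
Hypothesis hamming_code : forall x y,
  hamming (code x) (code y) = if x == y then 0 else (x != zero) + (y != zero).
Implicit Types u : seq T.

Definition encode u : seq bool := flatten [seq code x | x <- u].

Lemma encode_cat u1 u2 : encode (u1 ++ u2) = encode u1 ++ encode u2.
Proof. by rewrite /encode map_cat flatten_cat. Qed.

Lemma shape_code u : shape [seq code x | x <- u] = nseq (size u) m.
Proof. by elim: u => //= x u <-; rewrite size_code. Qed.

Lemma size_encode u : size (encode u) = m * size u.
Proof. by rewrite size_flatten shape_code sumn_nseq. Qed.

Lemma code_inj : injective code.
Proof.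
move=> x y eq_code; have := hamming_code x y; rewrite eq_code hamming_refl.
case: (eqVneq x y) => // + /esym/eqP.
by rewrite addn_eq0 !eqb0 !negbK => /[swap] /andP[/eqP-> /eqP->]; rewrite eqxx.
Qed.

Lemma encode_inj u u' : size u = size u' -> encode u = encode u' -> u = u'.
Proof.
move=> eq_size /eq_from_flatten_shape eq_map; apply: (inj_map code_inj).
by apply: eq_map; rewrite !shape_code eq_size.
Qed.

Lemma hamming_encode_cons x u y u' :
  hamming (encode (x :: u)) (encode (y :: u')) =
  (if x == y then 0 else (x != zero) + (y != zero)) +
  hamming (encode u) (encode u').
Proof. by rewrite hamming_cat ?size_code // hamming_code. Qed.

Lemma hamming_encode_raise u u' :
  in_context (raise_rule zero) u u' -> hamming (encode u) (encode u') = 1.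
Proof.
case=> a [c [_ [_ [[x x_zero] -> ->]]]]; rewrite !(encode_cat a) /=.
rewrite hamming_cat // hamming_encode_cons !hamming_refl.
by rewrite eq_sym (negPf x_zero) eqxx.
Qed.

Lemma hamming_encode_eq1 u u' : size u = size u' ->
  hamming (encode u) (encode u') = 1 ->
  in_context (raise_rule zero) u u' \/ in_context (raise_rule zero) u' u.
Proof.
elim: u u' => [|x u IH] [|y u'] //= [eq_size].
rewrite hamming_encode_cons; case: (eqVneq x y) => [->|x_y].
  move/(IH _ eq_size)=> [] [a [c [l [r [rule_lr -> ->]]]]]; [left | right];
    by exists (y :: a), c, l, r.
have eq_u : hamming (encode u) (encode u') = 0 -> u = u'.
  move/eqP; rewrite hamming_eq0 ?size_encode ?eq_size // => /eqP.
  exact: encode_inj.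
case: (eqVneq x zero) x_y => [->|x_zero];
  case: (eqVneq y zero) => [->|y_zero] //.
- move=> _ [/eq_u->]; left; exists [::], u', [:: zero], [:: y].
  by split=> //; apply: RaiseLetter.
- move=> _ [/eq_u->]; right; exists [::], u', [:: zero], [:: x].
  by split=> //; apply: RaiseLetter.
Qed.

Lemma hamming_encode_eq1P u u' : size u = size u' ->
  reflect (in_context (raise_rule zero) u u' \/
           in_context (raise_rule zero) u' u)
          (hamming (encode u) (encode u') == 1).
Proof.
move=> eq_size; apply: (iffP eqP); first exact: hamming_encode_eq1.
by case=> /hamming_encode_raise //; rewrite hamming_sym.
Qed.

End BlockCode.

(** * Munarini strings *)

Section MunariniBlocks.
Variable k : nat.

Lemma A_unit_vector i : i <= k -> A k i = [seq p == i | p <- iota 1 k].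
Proof.
move=> i_k; have map_false o m : ~~ (o <= i < o + m) ->
    [seq p == i | p <- iota o m] = nseq m false.
  move=> i_out.
  have /all_pred1P : all (pred1 false) [seq p == i | p <- iota o m].
    by rewrite all_map; apply/allP => p; rewrite mem_iota /=; lia.
  by rewrite size_map size_iota.
rewrite /A; case: eqP => [i0|/eqP i_neq0]; first by rewrite map_false // i0.
have -> : iota 1 k = iota 1 i.-1 ++ i :: iota i.+1 (k - i).
  have {1}-> : k = i.-1 + (k - i).+1 by lia.
  by rewrite iotaD add1n prednK // lt0n.
by rewrite map_cat /= eqxx !map_false //; lia.
Qed.

Lemma hamming_A i j : i <= k -> j <= k ->
  hamming (A k i) (A k j) = if i == j then 0 else (i != 0) + (j != 0).
Proof.
move=> i_k j_k; have [->|i_j] := eqVneq i j; first exact: hamming_refl.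
rewrite !A_unit_vector // hamming_map.
have mem_iota1 l : l <= k -> (l \in iota 1 k) = (l != 0).
  by rewrite mem_iota; lia.
rewrite -!mem_iota1 // -!count_uniq_mem ?iota_uniq // -count_predUI.
have /eq_count -> : predI (pred1 i) (pred1 j) =1 pred0 by move=> p /=; lia.
by rewrite count_pred0 addn0; apply: eq_count => p /=; lia.
Qed.

Lemma last_A i b : 0 < k -> i <= k -> last b (A k i) = (i == k).
Proof.
move=> k_gt0 i_k; rewrite A_unit_vector // -nth_last size_map size_iota.
rewrite (nth_map 0) ?size_iota ?nth_iota ?prednK //.
by rewrite add1n prednK // eq_sym.
Qed.

End MunariniBlocks.

Section MunariniCode.
Variable k : nat.
Hypothesis k_gt0 : 0 < k.
Implicit Types (u v : seq 'I_k.+1) (s : seq bool).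

Local Notation reduce := (scanl (swap_after ord0 ord_max) ord0).
Local Notation expand := (pairmap (swap_after ord0 ord_max) ord0).
Local Notation reduced := (reduced ord0 ord_max).
Local Notation reduced_block := (reduced_block ord0 ord_max).

Definition letter_code (i : 'I_k.+1) : seq bool := A k i.

Lemma size_letter_code i : size (letter_code i) = k.
Proof. exact: size_A k_gt0 (leq_ord i). Qed.

Lemma hamming_letter_code i j :
  hamming (letter_code i) (letter_code j) =
  if i == j then 0 else (i != ord0) + (j != ord0).
Proof. exact: hamming_A (leq_ord i) (leq_ord j). Qed.

Lemma encode_reduced_blocks v :
  encode letter_code (flatten [seq reduced_block i | i <- v]) =
  flatten [seq munarini_block i | i <- v].
Proof.
elim: v => //= i v <-; rewrite encode_cat; congr (_ ++ _).
rewrite /munarini_block /reduced_block.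
by case: ifP => _; rewrite /encode /= ?cats0.
Qed.

Lemma munarini_string_reducedP s :
  reflect (exists2 u, reduced u & s = encode letter_code u)
          (munarini_string k s).
Proof.
have reduced_flattenP u := reducedP (ord0_neq_max k_gt0) u.
apply: (iffP (munarini_stringP s k_gt0)) => [[v ->]|].
  exists (flatten [seq reduced_block i | i <- v]).
    by apply/reduced_flattenP; exists v.
  by rewrite encode_reduced_blocks.
by case=> _ /reduced_flattenP[v ->] ->; exists v; rewrite encode_reduced_blocks.
Qed.

Lemma last_munarini_string s : munarini_string k s -> last false s = false.
Proof.
case/munarini_stringP=> // v ->; elim: v => //= i v IH.
rewrite last_cat (_ : last false (munarini_block i) = false) //.
rewrite /munarini_block; case: eqVneq => [_|i_max].
  by rewrite last_cat last_A // ltn_eqF.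
by rewrite (last_A _ k_gt0 (leq_ord i)) (negPf i_max : (i == k :> nat) = false).
Qed.

Definition munarini_code v : seq bool := encode letter_code (reduce v).

Section FixedLength.
Variable n : nat.
Implicit Types w : n.-tuple 'I_k.+1.

Lemma size_munarini_code w : size (munarini_code w) == k * n.
Proof. by rewrite (size_encode size_letter_code) size_scanl size_tuple. Qed.

Lemma pell_string_reduced w : pell_string w = reduced (reduce w).
Proof.
exact: sameP (pell_stringP w k_gt0) (reduced_reduceP (ord0_neq_max k_gt0) w).
Qed.

Lemma munarini_string_code w :
  pell_string w -> munarini_string k (munarini_code w).
Proof.
rewrite pell_string_reduced => red_w; apply/munarini_string_reducedP.
by exists (reduce w).
Qed.

Lemma munarini_code_inj w w' : munarini_code w = munarini_code w' -> w = w'.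
Proof.
move/(encode_inj size_letter_code hamming_letter_code).
rewrite !size_scanl !size_tuple => /(_ erefl) eq_reduce.
exact/val_inj/(can_inj (reduceK (ord0_neq_max k_gt0)) eq_reduce).
Qed.

Lemma munarini_code_surj s : size s = k * n -> munarini_string k s ->
  exists2 w : n.-tuple 'I_k.+1, pell_string w & munarini_code w = s.
Proof.
move=> size_s /munarini_string_reducedP[u red_u sE].
have size_u : size u = n.
  apply/eqP; move/eqP: size_s.
  by rewrite sE (size_encode size_letter_code) eqn_pmul2l.
have size_w : size (expand u) == n by rewrite size_pairmap size_u.
have reduce_w := expandK (ord0_neq_max k_gt0) u.
exists (Tuple size_w); first by rewrite pell_string_reduced /= reduce_w.
by rewrite /munarini_code /= reduce_w.
Qed.

Lemma hamming_munarini_code w w' : pell_string w -> pell_string w' ->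
  (hamming (munarini_code w) (munarini_code w') == 1) =
  replace w w' || replace w' w.
Proof.
rewrite !pell_string_reduced => red_w red_w'.
have eq_size : size (reduce w) = size (reduce w').
  by rewrite !size_scanl !size_tuple.
have reduceP := pell_rule_reduce (ord0_neq_max k_gt0) red_w red_w'.
have reduceP' := pell_rule_reduce (ord0_neq_max k_gt0) red_w' red_w.
apply/(hamming_encode_eq1P size_letter_code hamming_letter_code eq_size)/orP.
- by case=> [/reduceP|/reduceP'] /replaceP; [left | right].
- by case=> /replaceP => [/reduceP|/reduceP']; [left | right].
Qed.

End FixedLength.
End MunariniCode.

Lemma munarini_graph_isomorphic n k (k_gt0 : 0 < k) :
  isomorphic (munarini_graph n k_gt0) (munarini_subcube n k).
Proof.
pose code (w : munarini_graph n k_gt0) :=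
  Tuple (size_munarini_code k_gt0 (val w)).
have code_munarini w : munarini_string k (code w).
  exact: (munarini_string_code k_gt0 (valP w)).
have code_fib w : fibonacci_string (code w).
  exact: munarini_string_fibonacci k_gt0 (code_munarini w).
pose f w : munarini_subcube n k :=
  exist _ (exist _ (code w) (code_fib w) : fibonacci_cube _) (code_munarini w).
apply: (@embedding_surj_isomorphic _ _ f).
  split=> [w w' [/(munarini_code_inj k_gt0)]|w w']; first exact: val_inj.
  rewrite [LHS]adj_fibonacci_cube.
  exact: (hamming_munarini_code k_gt0 (valP w) (valP w')).
case=> [[y y_fib] y_munarini].
have [w pell_w codeE] := munarini_code_surj k_gt0 (size_tuple y) y_munarini.
by apply/codomP; exists (exist _ w pell_w); do 3 apply: val_inj.
Qed.

(** * Dropping a final zero *)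

Lemma fibonacci_string_take m m' (x : m.-tuple bool) (y : m'.-tuple bool) :
  tval y = take m' x -> fibonacci_string x -> fibonacci_string y.
Proof.
move=> yE /forallP fib_x; have m'_m : m' <= m.
  by rewrite -(size_tuple y) yE size_take size_tuple; case: ltnP => // /ltnW.
have tnth_y i : tnth y i = tnth x (widen_ord m'_m i).
  by rewrite !(tnth_nth false) yE nth_take.
apply/forallP=> i; apply/forallP=> j; rewrite !tnth_y.
by have /forallP := fib_x (widen_ord m'_m i); apply.
Qed.

Lemma embedding_drop_last m (P : pred (fibonacci_cube m)) :
  (forall x, P x -> last false (val x) = false) ->
  exists f : induced P -> fibonacci_cube (m - 1), embedding f.
Proof.
move=> last0.
have size_trunc (x : fibonacci_cube m) : size (take (m - 1) (val x)) == m - 1.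
  by rewrite size_takel // size_tuple leq_subr.
pose trunc (x : induced P) := Tuple (size_trunc (val x)).
have trunc_fib x : fibonacci_string (trunc x).
  by apply: fibonacci_string_take (valP (val x)).
have hamming_trunc x y :
    hamming (trunc x) (trunc y) = hamming (val (val x)) (val (val y)).
  rewrite -(@hamming_drop_last _ false (val (val x))) ?size_tuple //.
  by rewrite !(last0 _ (valP _)).
exists (fun x => exist _ (trunc x) (trunc_fib x)); split=> [x y [eq_trunc]|x y].
  do 3 apply: val_inj; apply/eqP; rewrite -hamming_eq0 ?size_tuple //.
  by rewrite -hamming_trunc /= eq_trunc hamming_refl.
by rewrite adj_fibonacci_cube [RHS]adj_fibonacci_cube hamming_trunc.
Qed.

Theorem theorem3p1 (k n : nat) (k_gt0 : 0 < k) :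
  isomorphic (munarini_graph n k_gt0) (munarini_subcube n k) /\
  (0 < n -> exists H : subgraph (fibonacci_cube (k * n - 1)),
              isomorphic (munarini_graph n k_gt0) H).
Proof.
have [f [f_bij f_adj]] := munarini_graph_isomorphic n k_gt0.
split=> [|_]; first by exists f.
have f_emb : embedding f by split; [exact: bij_inj | exact: f_adj].
have [g g_emb] := embedding_drop_last
  (fun x : fibonacci_cube (k * n) => @last_munarini_string k k_gt0 (val x)).
exact: embedding_isomorphic_subgraph (embedding_comp f_emb g_emb).
Qed.
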